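(* Let $Q$ be a quandle with multiplication $m\colon Q\times Q\to Q$ and inverse operation $\bar m$, so that $\bar m(m(q,h),h)=m(\bar m(q,h),h)=q$ for all $q,h\in Q$. Let $A\subset \mathrm{Aut}(Q)$ be a subgroup of order $n$, let $X=Q/A$ be the set of $A$-orbits and let $\pi\colon Q\to X$ be the canonical projection. Then the $n$-valued multiplication $$\mu(x,y)=x*y=\pi\big(m(\pi^{-1}(x),\pi^{-1}(y))\big),\qquad x,y\in X,$$ defines an $n$-valued quandle structure on the orbit space $X=Q/A$ (called the coset $n$-valued quandle of $(Q,A)$), with the inverse operation $$x\,\bar*\,y=\pi\big(\bar m(\pi^{-1}(x),\pi^{-1}(y))\big).$$
   Context: A quandle is a non-empty set $Q$ with a binary operation $m(x,y)=x*y$ satisfying: $x*x=x$ for all $x$; for any $x,y$ there is a unique $z$ with $x=z*y$; $(x*y)*z=(x*z)*(y*z)$ for all $x,y,z$. $\mathrm{Aut}(Q)$ is the group of bijections of $Q$ preserving $m$. $\mathrm{Sym}^n(X)$ is the set of $n$-element multisets of elements of $X$; an $n$-valued multiplication on $X$ is a map $X\times X\to\mathrm{Sym}^n(X)$, $x*y=[(x*y)_1,\dots,(x*y)_n]$. The $n$-multiset $\pi(m(\pi^{-1}(x),\pi^{-1}(y)))$ is understood, as in the coset construction of $n$-valued groups, as follows: for $x=\pi(g)$, $y=\pi(h)$ with $g,h\in Q$, $$x*y=[\,\pi(m(g,a(h)))\;:\;a\in A\,],\qquad x\,\bar*\,y=[\,\pi(\bar m(g,a(h)))\;:\;a\in A\,],$$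 each a multiset of $n=|A|$ elements indexed by $a\in A$ (well-definedness, i.e. independence of the choice of $g,h$, is part of the assertion). Iterated products are multisets: $(x\star y)\diamond z$ is the $n^2$-multiset of all $((x\star y)_i\diamond z)_j$, and $(x*z)*(y*z)$ is the $n^3$-multiset of all $((x*z)_i*(y*z)_j)_k$. An $n$-valued quandle is a triple $(X,*,\bar* )$ where $X$ is a non-empty set and $*,\bar*$ are $n$-valued multiplications on $X$ such that: (M1) for any $x,y\in X$ the element $x$ lies in the $n^2$-multiset $(x*y)\,\bar*\,y$ and in the $n^2$-multiset $(x\,\bar*\,y)*y$; (M2) for any $x,y,z\in X$ the $n^2$-multiset $(x*y)*z$ is a subset (sub-multiset) of the $n^3$-multiset $(x*z)*(y*z)$; (M3) for any $x\in X$ the multiset $x*x$ contains $x$. *)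

(* Defs.v *)
From HB Require Import structures.
From mathcomp Require Import all_boot.
From mathcomp Require Import finmap multiset.
From mathcomp Require Import boolp classical_sets.

Set Implicit Arguments.
Unset Strict Implicit.
Unset Printing Implicit Defensive.

Local Open Scope mset_scope.
Local Open Scope classical_set_scope.

Record is_quandle (Q : Type) (m : Q -> Q -> Q) : Prop := IsQuandle {
  quandle_inhabited : inhabited Q;
  quandle_idem : forall x, m x x = x;
  quandle_div : forall x y, exists! z, x = m z y;
  quandle_dist : forall x y z, m (m x y) z = m (m x z) (m y z) }.

Record quandle_aut (Q : Type) (m : Q -> Q -> Q) : Type := QuandleAut {
  aut_fun :> Q -> Q;
  aut_bij : bijective aut_fun;
  autM : forall x y, aut_fun (m x y) = m (aut_fun x) (aut_fun y) }.

Section AutGroup.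
Variables (Q : Type) (m : Q -> Q -> Q).
Implicit Types f g h : quandle_aut m.

Lemma aut_eqP f g : f =1 g -> f = g.
Proof.
case: f g => [f fb fM] [g gb gM] /= /funext fg.
case: _ / fg in gb gM *.
by congr QuandleAut; exact: Prop_irrelevance.
Qed.

Definition aut_one : quandle_aut m :=
  @QuandleAut Q m id (Bijective (fun=> erefl) (fun=> erefl)) (fun _ _ => erefl).

Lemma aut_mulM f g x y : (f \o g) (m x y) = m ((f \o g) x) ((f \o g) y).
Proof. by rewrite /= !autM. Qed.

Definition aut_mul f g : quandle_aut m :=
  QuandleAut (bij_comp (aut_bij f) (aut_bij g)) (aut_mulM f g).

Lemma aut_inv_subproof f : exists g : Q -> Q, cancel f g /\ cancel g f.
Proof. by case: (aut_bij f) => g fK gK; exists g. Qed.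

Definition aut_inv_fun f : Q -> Q := projT1 (cid (aut_inv_subproof f)).

Lemma aut_funK f : cancel f (aut_inv_fun f).
Proof. by rewrite /aut_inv_fun; case: cid => g []. Qed.

Lemma aut_inv_funK f : cancel (aut_inv_fun f) f.
Proof. by rewrite /aut_inv_fun; case: cid => g []. Qed.

Lemma aut_invM f x y :
  aut_inv_fun f (m x y) = m (aut_inv_fun f x) (aut_inv_fun f y).
Proof. by apply: (can_inj (aut_funK f)); rewrite autM !aut_inv_funK. Qed.

Definition aut_inv f : quandle_aut m :=
  QuandleAut (Bijective (aut_inv_funK f) (aut_funK f)) (aut_invM f).

HB.instance Definition _ := gen_eqMixin (quandle_aut m).
HB.instance Definition _ := gen_choiceMixin (quandle_aut m).

Lemma aut_mulA : associative aut_mul.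
Proof. by move=> f g h; apply: aut_eqP. Qed.

Lemma aut_1mul : left_id aut_one aut_mul.
Proof. by move=> f; apply: aut_eqP. Qed.

Lemma aut_mul1 : right_id aut_one aut_mul.
Proof. by move=> f; apply: aut_eqP. Qed.

Lemma aut_Vmul : left_inverse aut_one aut_inv aut_mul.
Proof. by move=> f; apply: aut_eqP; exact: aut_funK. Qed.

Lemma aut_mulV : right_inverse aut_one aut_inv aut_mul.
Proof. by move=> f; apply: aut_eqP; exact: aut_inv_funK. Qed.

HB.instance Definition _ := isGroup.Build (quandle_aut m)
  aut_mulA aut_1mul aut_mul1 aut_Vmul aut_mulV.

End AutGroup.

Definition Sym (n : nat) (X : choiceType) : Type :=
  {s : {mset X} | size s == n}.

Definition nvalued_mul (n : nat) (X : choiceType) : Type := X -> X -> Sym n X.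

(* An n-valued operation extended to multisets, with multiplicities;
   a point z of X acts as the multiset [mset z]. *)
Definition mset_mul n (X : choiceType) (op : nvalued_mul n X)
    (s t : {mset X}) : {mset X} :=
  \big[msetD/mset0]_(u <- s) \big[msetD/mset0]_(v <- t) val (op u v).

Record is_nvalued_quandle n (X : choiceType) (star barstar : nvalued_mul n X) :
    Prop := IsNvaluedQuandle {
  nquandle_inhabited : inhabited X;
  nquandle_inv : forall x y : X,
    x \in mset_mul barstar (val (star x y)) [mset y]%mset /\
    x \in mset_mul star (val (barstar x y)) [mset y]%mset;
  nquandle_dist : forall x y z : X,
    (mset_mul star (val (star x y)) [mset z]
      `<=` mset_mul star (val (star x z)) (val (star y z)))%mset;
  nquandle_idem : forall x : X, x \in val (star x x) }.

Section Orbits.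
Variables (Q : Type) (m : Q -> Q -> Q) (A : {fset quandle_aut m}).

Definition aut_orbit (q : Q) : set Q := [set a q | a in [set` A]].

Definition orbit_space := set_type (range aut_orbit).
HB.instance Definition _ := Choice.on orbit_space.

Definition orbit_proj (q : Q) : orbit_space :=
  SigSub (mem_set (imageT aut_orbit q)).

(* star is well defined on orbits by
   pi g * pi h = [pi (f g (a h)) : a in A]. *)
Definition is_coset_mul (f : Q -> Q -> Q) n (star : nvalued_mul n orbit_space) :
    Prop :=
  forall g h : Q, val (star (orbit_proj g) (orbit_proj h)) =
    seq_mset [seq orbit_proj (f g (a h)) | a : quandle_aut m <- A].

End Orbits.

(* Main.v *)
Require Import Defs.
From mathcomp Require Import all_boot.
From mathcomp Require Import finmap multiset.
From mathcomp Require Import boolp classical_sets.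

(** Multisets are compared through their multiplicities. For orbits of [g], [h]
    and [k], the multiplicity of an orbit [w] in [pi g * pi h] is the number of
    [a] in [A] with [pi (g * a h) = w], and for iterated products it is a sum of
    such numbers over two or three indices running through [A].

    The operation on orbits is well defined because changing representatives to
    [b g] and [c h] turns the family [pi (g * a h)] into
    [pi (b g * a (c h)) = pi (g * (b^-1 a c) h)], which is the same family
    reindexed by a permutation of [A] ([coset_family_indep]). The argument needs
    [A] to act by automorphisms of the operation at hand, and it applies to the
    inverse operation too, since the automorphisms of a quandle preserve it
    ([quandle_aut_inv]).

    The idempotence and invertibility axioms are witnessed by the index [a = 1].
    For distributivity, the terms of [(x * y) * z] are
    [pi ((g * a h) * b k) = pi ((g * b k) * (a h * b k))], indexed by two elements
    of [A], whereas those of [(x * z) * (y * z)] are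
    [pi ((g * b k) * d (h * c k)) = pi ((g * b k) * (d h * (d c) k))], indexed by
    three; the former are the terms of the latter with [d = a] and
    [c = a^-1 b]. *)

Set Implicit Arguments.
Unset Strict Implicit.
Unset Printing Implicit Defensive.

Local Open Scope mset_scope.
Local Open Scope nat_scope.

(** * Multiplicities in products of multisets *)

Lemma mset_mulE n (X : choiceType) (op : nvalued_mul n X) (s t : {mset X}) w :
  mset_mul op s t w = \sum_(u <- s) \sum_(v <- t) val (op u v) w.
Proof.
have evD : {morph (fun B : {mset X} => B w) : B C / msetD B C >-> B + C}.
  by move=> B C; rewrite msetE2.
have ev0 : (mset0 : {mset X}) w = 0 by rewrite mset0E.
rewrite /mset_mul (big_morph _ evD ev0); apply: eq_bigr => u _.
exact: (big_morph _ evD ev0).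
Qed.

Lemma mem_mset_mul n (X : choiceType) (op : nvalued_mul n X) (s t : {mset X})
    u v w :
  u \in s -> v \in t -> w \in val (op u v) -> w \in mset_mul op s t.
Proof.
move=> us vt wuv.
by rewrite in_mset mset_mulE (big_rem u us) /= (big_rem v vt) /= -addnA
           ltn_addr // -in_mset.
Qed.

Lemma big_seq_mset (I : Type) (X : choiceType) (r : seq I) (F : I -> X)
    (G : X -> nat) :
  \sum_(u <- seq_mset [seq F i | i <- r]) G u = \sum_(i <- r) G (F i).
Proof. by rewrite (perm_big _ (perm_eq_seq_mset _)) big_map. Qed.

Lemma seq_mset_mapE (I : Type) (X : choiceType) (r : seq I) (F : I -> X) w :
  seq_mset [seq F i | i <- r] w = \sum_(i <- r) (F i == w).
Proof. by rewrite mset_seqE -sum1_count big_map big_mkcond. Qed.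

(** * Reindexing along a finite subgroup *)

Section Reindex.
Variables (G : groupType) (A : {fset G}).
Hypothesis closedA : group_closed [in A].

Lemma perm_mulg b c : b \in A -> c \in A ->
  perm_eq [seq (b * a * c)%g | a <- A] A.
Proof.
move=> bA cA.
have AM := group_closedM closedA; have AV := group_closedV closedA.
apply: uniq_perm => [||a]; [|exact: fset_uniq|].
- rewrite map_inj_uniq ?fset_uniq // => u v /mulIg; exact: mulgI.
- apply/mapP/idP => [[u uA ->]|aA]; first exact: AM (AM _ _ bA uA) cA.
  exists (b^-1 * a * c^-1)%g; last by rewrite !mulgA mulgV mul1g mulgVK.
  exact: AM (AM _ _ (AV _ bA) aA) (AV _ cA).
Qed.

End Reindex.

(** * Orbits *)

(** An automorphism carries the unique solution [z] of [m z y = x] to the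
    solution of the transported equation. *)
Lemma quandle_aut_inv (Q : Type) (m mbar : Q -> Q -> Q)
    (mbarP : forall q h, mbar (m q h) h = q /\ m (mbar q h) h = q)
    (a : quandle_aut m) x y :
  a (mbar x y) = mbar (a x) (a y).
Proof.
have [_ mK] := mbarP x y.
by rewrite -[in RHS]mK autM; case: (mbarP (a (mbar x y)) (a y)) => ->.
Qed.

Section Orbits.
Variables (Q : Type) (m : Q -> Q -> Q) (A : {fset quandle_aut m}).
Hypothesis closedA : group_closed [in A].
Local Notation pi := (orbit_proj A).

Lemma orbit_projE a q : a \in A -> pi (a q) = pi q.
Proof.
move=> aA; have AM := group_closedM closedA; have AV := group_closedV closedA.
apply/val_inj/seteqP; split=> _ [b bA <-] /=.
  by exists (b * a)%g => //; exact: AM.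
exists (b * a^-1)%g; first exact: AM bA (AV _ aA).
by rewrite -[b in RHS](mulgVK a).
Qed.

Lemma orbit_proj_eq g g' : pi g = pi g' -> exists2 b, b \in A & g = b g'.
Proof.
move=> /(congr1 val)/= eq_orb.
have : aut_orbit A g g by exists 1%g => //; case: closedA.
by rewrite eq_orb => -[b bA <-]; exists b.
Qed.

Lemma orbit_proj_surj (x : orbit_space A) : exists q, pi q = x.
Proof.
by case: x => s sP; have [q _ eqs] := set_mem sP; exists q; apply: val_inj.
Qed.

Section CosetMul.
Variable f : Q -> Q -> Q.
Hypothesis fM : forall a, a \in A -> forall x y, a (f x y) = f (a x) (a y).

(** Writing [g = b g'] and [h = c h'], the automorphism [b] carries the point
    [f g' (b^-1 a c h')] behind the index [b^-1 a c] of the second family to the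
    point [f g (a h)] behind the index [a] of the first, so both lie in the same
    orbit. *)
Lemma coset_family_indep g g' h h' : pi g = pi g' -> pi h = pi h' ->
  seq_mset [seq pi (f g (a h)) | a : quandle_aut m <- A] =
  seq_mset [seq pi (f g' (a h')) | a : quandle_aut m <- A].
Proof.
move=> /orbit_proj_eq[b bA ->] /orbit_proj_eq[c cA ->].
have AV := group_closedV closedA.
apply/eq_seq_msetP.
rewrite -(permPr (perm_map _ (perm_mulg closedA (AV _ bA) cA))) -map_comp.
apply: etrans (perm_refl _); congr perm_eq; apply: eq_map => a /=.
rewrite -(orbit_projE (f (b g') _) (AV _ bA)) fM ?AV //.
by congr (pi (f _ _)); exact/esym/aut_funK.
Qed.

Lemma coset_mul_exists n : #|` A| = n ->
  exists star : nvalued_mul n (orbit_space A), is_coset_mul f star.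
Proof.
move=> cardA; pose repr x := projT1 (cid (orbit_proj_surj x)).
have reprK x : pi (repr x) = x by rewrite /repr; case: cid.
pose fam x y :=
  seq_mset [seq pi (f (repr x) (a (repr y))) | a : quandle_aut m <- A].
have size_fam x y : size (fam x y) == n.
  by rewrite (perm_size (perm_eq_seq_mset _)) size_map cardA.
by exists (fun x y => exist _ (fam x y) (size_fam x y)) => g h /=;
   apply: coset_family_indep; rewrite reprK.
Qed.

End CosetMul.

Lemma mem_coset_mul f n (star : nvalued_mul n (orbit_space A)) g h :
  is_coset_mul f star -> pi (f g h) \in val (star (pi g) (pi h)).
Proof.
move=> ->; rewrite (perm_mem (perm_eq_seq_mset _)).
by apply/mapP; exists 1%g => //; case: closedA.
Qed.

End Orbits.

(** * The quandle axioms *)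

Section CosetQuandle.
Variables (Q : Type) (m : Q -> Q -> Q) (A : {fset quandle_aut m}).
Hypothesis closedA : group_closed [in A].
Local Notation pi := (orbit_proj A).

(** With representatives [g] and [h], the orbit of [f g h] is the term with
    index 1 of [x * y], and the orbit of [f' (f g h) h = g] is then the term
    with index 1 of its product with [y]. *)
Lemma coset_mul_cancel f f' n (star star' : nvalued_mul n (orbit_space A)) :
  is_coset_mul f star -> is_coset_mul f' star' ->
  (forall g h, f' (f g h) h = g) ->
  forall x y, x \in mset_mul star' (val (star x y)) [mset y].
Proof.
move=> cf cf' fK x y.
have [[g <-] [h <-]] := (orbit_proj_surj x, orbit_proj_surj y).
apply: (mem_mset_mul (mem_coset_mul closedA g h cf) (mset11 _)).
by rewrite -[in X in X \in _](fK g h); apply: mem_coset_mul.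
Qed.

(** Both multiplicities become sums over [b], which acts on the representative
    of [z], and over [a], which acts on the representative of [y]; they are
    compared for each pair [(a, b)], where the right-hand side still has a sum
    over a third index. *)
Lemma coset_mul_dist n (star : nvalued_mul n (orbit_space A)) :
  is_coset_mul m star ->
  (forall x y z, m (m x y) z = m (m x z) (m y z)) ->
  forall x y z, (mset_mul star (val (star x y)) [mset z] `<=`
                 mset_mul star (val (star x z)) (val (star y z)))%mset.
Proof.
move=> cm distm x y z.
have [[g <-] [[h <-] [k <-]]] :=
  (orbit_proj_surj x, (orbit_proj_surj y, orbit_proj_surj z)).
apply/msubsetP => w; rewrite !mset_mulE !cm !big_seq_mset.
under eq_bigr do rewrite big_msetn /= cm seq_mset_mapE.
rewrite exchange_big /=.
rewrite big_seq [leqRHS]big_seq; apply: leq_sum => b bA.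
rewrite big_seq_mset.
under [leqRHS]eq_bigr do rewrite cm seq_mset_mapE.
rewrite [leqRHS]exchange_big /=.
rewrite big_seq [leqRHS]big_seq; apply: leq_sum => a aA.
under [leqRHS]eq_bigr do rewrite autM.
(* Among the elements [c] of [A], the one with [a (c k) = b k]. *)
have cA : (a^-1 * b)%g \in A.
  exact: group_closedM closedA _ _ (group_closedV closedA aA) bA.
have acK : a ((a^-1 * b)%g k) = b k by exact: aut_inv_funK.
by rewrite (big_rem _ cA) /= acK -distm leq_addr.
Qed.

End CosetQuandle.

Theorem theorem3p4 (Q : Type) (m mbar : Q -> Q -> Q) (hm : is_quandle m)
  (hmbar : forall q h : Q, mbar (m q h) h = q /\ m (mbar q h) h = q)
  (n : nat) (A : {fset quandle_aut m}) (hA : group_closed [in A])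
  (hn : #|` A | = n) :
  exists star barstar : nvalued_mul n (orbit_space A),
    [/\ is_coset_mul m star, is_coset_mul mbar barstar
      & is_nvalued_quandle star barstar].
Proof.
have distm := quandle_dist hm.
have fM (a : quandle_aut m) : a \in A -> forall x y, a (m x y) = m (a x) (a y).
  by move=> _; exact: autM.
have gM (a : quandle_aut m) : a \in A ->
    forall x y, a (mbar x y) = mbar (a x) (a y).
  by move=> _; exact: quandle_aut_inv.
have [star cm] := coset_mul_exists hA fM hn.
have [barstar cmbar] := coset_mul_exists hA gM hn.
exists star, barstar; split=> //; split=> [|x y||x].
- by case: hm => -[q] _ _ _; split; exact: orbit_proj A q.
- split; first by apply: coset_mul_cancel cm cmbar _ x y => // g h;
                  case: (hmbar g h).
  by apply: coset_mul_cancel cmbar cm _ x y => // g h; case: (hmbar g h).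
- exact: coset_mul_dist.
- have [g <-] := orbit_proj_surj x.
  by rewrite -[in X in X \in _](quandle_idem hm g); exact: mem_coset_mul.
Qed.
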